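(* Let $p$ be a smooth function on $(0,\infty)$ with $p'(v)<0<p''(v)$ for all $v>0$, and fix a right state $(v_+,u_+)$ with $v_+>0$. There exists a constant $\delta_0>0$ such that the following holds for every left state $(v_-,u_-)$ and speed $s$ with $v_->v_+$, $s<0$, $u_+<u_-$, $$-s(v_+-v_-)-(u_+-u_-)=0,\qquad -s(u_+-u_-)+\big(p(v_+)-p(v_-)\big)=0,$$ and $\delta:=|v_+-v_-|\le\delta_0$. Let $(v^s,u^s)(x,t)$ be the corresponding 1-shock of the Euler equations $v_t-u_x=0$, $u_t+p(v)_x=0$, i.e. $(v^s,u^s)(x,t)=(v_-,u_-)$ for $x<st$ and $(v^s,u^s)(x,t)=(v_+,u_+)$ for $x>st$. Then for every $\alpha>0$ the Navier-Stokes system $$v_t-u_x=0,\qquad u_t+p(v)_x=\alpha\Big(\frac{u_x}{v^{1+\alpha}}\Big)_x,\qquad x\in\mathbb R,\ t\ge 0,$$ with initial data $(v,u)(x,0)=(V^\alpha,U^\alpha)(x,0)$ admits a global smooth solution $(v^\alpha,u^\alpha)(x,t)$ (with $v^\alpha>0$). Moreover, for every constant $h>0$, with $\Omega=\{(x,t): |x-st|\ge h,\ h\le t<+\infty\}$, $$\|(v^\alpha-v^s,\,u^\alpha-u^s)\|_{L^\infty(\Omega)}\to 0\quad\text{as }\alpha\to 0.$$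
   Context: Definition of $(V^\alpha,U^\alpha)$. For given $\alpha>0$ and $(v_\pm,u_\pm,s)$ as in the claim, let $(V,U)(\xi)$, $\xi\in\mathbb R$ (depending on $\alpha$), be the viscous shock profile, i.e. the smooth solution, with $V>0$, of $$-sV_\xi-U_\xi=0,\qquad -sU_\xi+p(V)_\xi=\Big(\frac{U_\xi}{V^{1+\alpha}}\Big)_\xi,\qquad (V,U)(\pm\infty)=(v_\pm,u_\pm).$$ It exists and is unique up to a shift in $\xi$; the shift is fixed by $V(0)=\frac{v_-+v_+}{2}$. Set $V^\alpha(x,t):=V\big(\tfrac{x-st}{\alpha}\big)$ and $U^\alpha(x,t):=U\big(\tfrac{x-st}{\alpha}\big)$. *)

(* Defs.v *)
From HB Require Import structures.
From mathcomp Require Import all_boot all_order all_algebra.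
From mathcomp Require Import all_classical all_reals all_analysis.
Set Implicit Arguments.
Unset Strict Implicit.
Unset Printing Implicit Defensive.
Import Order.TTheory GRing.Theory Num.Theory.
Import numFieldNormedType.Exports.
Local Open Scope classical_set_scope.
Local Open Scope ring_scope.

Section Defs.
Context {R : realType}.

(* Meaningful for open D only: all derivatives are two-sided. *)
Definition smooth_on (D : set R) (f : R -> R) : Prop :=
  forall n x, D x -> derivable (derive1n n f) x 1.

(* Points of space-time are pairs (x, t). *)
Definition Dx (f : R * R -> R) (z : R * R) : R := 'D_((1, 0) : R * R) f z.
Definition Dt (f : R * R -> R) (z : R * R) : R := 'D_((0, 1) : R * R) f z.

Fixpoint Ck_on (k : nat) (O : set (R * R)) (f : R * R -> R) : Prop :=
  if k is k'.+1 then
    [/\ forall z, O z -> derivable f z ((1, 0) : R * R),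
        forall z, O z -> derivable f z ((0, 1) : R * R),
        Ck_on k' O (Dx f) & Ck_on k' O (Dt f)]
  else forall z, O z -> {for z, continuous f}.

(* A function is smooth on a set that need not be open if it is smooth on an
   open neighbourhood of it. On the closed half-plane t >= 0 the derivatives
   at t = 0 are then two-sided ones, which agree with the one-sided ones. *)
Definition smooth2_on (D : set (R * R)) (f : R * R -> R) : Prop :=
  exists O : set (R * R),
    [/\ open O, D `<=` O & forall k, Ck_on k O f].

Record viscous_shock_profile (p : R -> R) (vm um vp up s alpha : R)
    (V U : R -> R) : Prop := {
  profile_smoothV : smooth_on setT V ;
  profile_smoothU : smooth_on setT U ;
  profile_gt0 : forall xi, 0 < V xi ;
  profile_mass : forall xi, - s * derive1 V xi - derive1 U xi = 0 ;
  profile_momentum : forall xi,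
    - s * derive1 U xi + derive1 (p \o V) xi
    = derive1 (fun eta => derive1 U eta / V eta `^ (1 + alpha)) xi ;
  profile_Vm : V xi @[xi --> -oo] --> vm ;
  profile_Vp : V xi @[xi --> +oo] --> vp ;
  profile_Um : U xi @[xi --> -oo] --> um ;
  profile_Up : U xi @[xi --> +oo] --> up ;
  profile_shift : V 0 = (vm + vp) / 2 }.

Definition travelling_wave (s alpha : R) (F : R -> R) (z : R * R) : R :=
  F ((z.1 - s * z.2) / alpha).

(* The value on the null set x = s t is immaterial. *)
Definition shock (s left right : R) (z : R * R) : R :=
  if z.1 < s * z.2 then left else right.

Record navier_stokes_solution (p : R -> R) (alpha : R) (v0 u0 : R -> R)
    (v u : R * R -> R) : Prop := {
  ns_smoothv : smooth2_on [set z | 0 <= z.2] v ;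
  ns_smoothu : smooth2_on [set z | 0 <= z.2] u ;
  ns_gt0 : forall x t, 0 <= t -> 0 < v (x, t) ;
  ns_mass : forall x t, 0 <= t -> Dt v (x, t) - Dx u (x, t) = 0 ;
  ns_momentum : forall x t, 0 <= t ->
    Dt u (x, t) + Dx (p \o v) (x, t)
    = alpha * Dx (fun z => Dx u z / v z `^ (1 + alpha)) (x, t) ;
  ns_initv : forall x, v (x, 0) = v0 x ;
  ns_initu : forall x, u (x, 0) = u0 x }.

(* Essential supremum over Omega, for the Lebesgue measure of the plane, of
   the norm of the pair (f, g). *)
Definition Linfty_norm (Omega : set (R * R)) (f g : R * R -> R) : \bar R :=
  Lnorm (@lebesgue_measure R \x @lebesgue_measure R)%E +oo%E
    (EFin \o ((fun z => `|((f z, g z) : R * R)|) \_ Omega)).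

Definition away_from_shock (s h : R) : set (R * R) :=
  [set z | h <= `|z.1 - s * z.2| /\ h <= z.2].

End Defs.

(* Main.v *)
Require Import Defs.
From HB Require Import structures.
From mathcomp Require Import all_boot all_order all_algebra.
From mathcomp Require Import all_classical all_reals all_analysis.
From mathcomp Require Import ess_sup_inf ring lra.
Set Implicit Arguments.
Unset Strict Implicit.
Import Order.TTheory GRing.Theory Num.Theory.
Import numFieldNormedType.Exports.
Local Open Scope classical_set_scope.
Local Open Scope ring_scope.

(* The travelling wave (V,U)((x - s t)/alpha) itself solves the Navier-Stokes
   system, so only the profile has to be studied. Integrating the profile
   equations once turns them into the scalar equation
   V' = V^(1+alpha) g(V) / (-s) with U = up - s (V - vp), where
   g v = s^2 (v - vp) + p v - p vp is strictly convex and, by the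
   Rankine-Hugoniot conditions, vanishes at vp and vm. Hence V decreases from vm
   to vp, and on compact subsets of (vp, vm) the right-hand side is bounded away
   from 0 uniformly in 0 < alpha <= 1. So V is close to its limits outside an
   interval [-T, T] with T independent of alpha; since |x - s t| >= h means
   |xi| >= h/alpha, the convergence follows. *)

(** * Smooth functions and autonomous equations *)

Lemma is_derive_continuous (R : realType) (f : R -> R) (x df : R) :
  is_derive x 1 f df -> {for x, continuous f}.
Proof. by case=> + _ => /derivable1_diffP/differentiable_continuous. Qed.

Lemma is_derive_mean_value (R : realType) (f df : R -> R) (a b : R) :
  a < b -> (forall x, a <= x <= b -> is_derive x 1 f (df x)) ->
  exists2 c, a < c < b & f b - f a = df c * (b - a).
Proof.
move=> ab fdf.
have [||c cab ->] := @MVT R f df a b ab; last by exists c.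
- by move=> x xab; apply: fdf; rewrite !ltW ?(itvP xab).
- apply: continuous_in_subspaceT => x; rewrite inE/= in_itv/= => /fdf.
  exact: is_derive_continuous.
Qed.

Section smooth.
Context {R : realType}.
Implicit Types (D : set R) (f g F V : R -> R).

Lemma smooth_on_is_derive D f x :
  smooth_on D f -> D x -> is_derive x 1 f ((derive1 f) x).
Proof. by move=> sf Dx; rewrite derive1E; apply: derivableP; exact: (sf 0%N). Qed.

Lemma smooth_on_derive1 D f : smooth_on D f -> smooth_on D (derive1 f).
Proof. by move=> sf n x Dx; rewrite -derive1Sn; exact: sf. Qed.

(** By induction every iterated derivative agrees on [D] with a member of [P]; openness of [D] lets
    this agreement pass to the next derivative. Smoothness is thus proved by exhibiting a class of
    functions stable under differentiation. *)
Lemma smooth_on_coind D (P : (R -> R) -> Prop) : open D ->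
  (forall f, P f -> exists2 g, P g & forall x, D x -> is_derive x 1 f (g x)) ->
  forall f, P f -> smooth_on D f.
Proof.
move=> oD PD f Pf n.
have [g Pg gE] : exists2 g, P g & forall x, D x -> derive1n n f x = g x.
  elim: n => [|n [g /PD[h Ph dg] gE]]; first by exists f.
  exists h => // x Dx; rewrite derive1nS derive1E.
  rewrite (@near_eq_derive _ _ _ _ g).
    by have [] := dg x Dx.
  by near=> y; apply: gE; near: y; exact: open_nbhs_nbhs.
move=> x Dx; apply: (@near_eq_derivable _ _ _ g).
  by near=> y; apply/esym/gE; near: y; exact: open_nbhs_nbhs.
by have [h _ /(_ x Dx)[]] := PD g Pg.
Unshelve. all: by end_near. Qed.

(* As this algebra is stable under differentiation, sums and products of smooth
   functions are smooth without any Leibniz formula of higher order. *)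
Inductive smooth_alg D : (R -> R) -> Prop :=
| smooth_alg_base f : smooth_on D f -> smooth_alg D f
| smooth_algD f g : smooth_alg D f -> smooth_alg D g ->
    smooth_alg D (fun x => f x + g x)
| smooth_algM f g : smooth_alg D f -> smooth_alg D g ->
    smooth_alg D (fun x => f x * g x).

Lemma smooth_on_alg D f : open D -> smooth_alg D f -> smooth_on D f.
Proof.
move=> oD; apply: smooth_on_coind => // {}f.
elim=> {f} [f sf|f g af [f' af' df] ag [g' ag' dg]
  |f g af [f' af' df] ag [g' ag' dg]].
- exists (derive1 f); first exact/smooth_alg_base/smooth_on_derive1.
  by move=> x; exact: smooth_on_is_derive.
- exists (fun x => f' x + g' x); first exact: smooth_algD.
  by move=> x Dx; apply: is_deriveD; [exact: df|exact: dg].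
- exists (fun x => f x * g' x + g x * f' x).
    by apply: smooth_algD; apply: smooth_algM.
  by move=> x Dx; apply: is_deriveM; [exact: df|exact: dg].
Qed.

Lemma smooth_onD D f g : open D -> smooth_on D f -> smooth_on D g ->
  smooth_on D (fun x => f x + g x).
Proof.
by move=> oD sf sg; apply: smooth_on_alg => //; apply: smooth_algD;
  exact: smooth_alg_base.
Qed.

Lemma smooth_onM D f g : open D -> smooth_on D f -> smooth_on D g ->
  smooth_on D (fun x => f x * g x).
Proof.
by move=> oD sf sg; apply: smooth_on_alg => //; apply: smooth_algM;
  exact: smooth_alg_base.
Qed.

Lemma smooth_on_cst D (c : R) : open D -> smooth_on D (fun=> c).
Proof.
move=> oD; pose P (f : R -> R) := exists c, f = fun=> c.
apply: (@smooth_on_coind D P oD); last by exists c.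
by move=> _ [a ->]; exists (fun=> 0) => [|x _]; [exists 0|exact: is_derive_cst].
Qed.

Lemma smooth_on_id D : open D -> smooth_on D id.
Proof.
move=> oD; pose P (f : R -> R) := f = id \/ smooth_on D f.
apply: (@smooth_on_coind D P oD); last by left.
move=> f [->|sf].
  exists (fun=> 1) => [|x _]; last exact: is_derive_id.
  by right; exact: smooth_on_cst.
exists (derive1 f) => [|x]; first by right; exact: smooth_on_derive1.
exact: smooth_on_is_derive.
Qed.

Lemma smooth_on_powR (a : R) : smooth_on [set x | 0 < x] (fun x => x `^ a).
Proof.
pose P (f : R -> R) := exists c b, f = fun x => c * x `^ b.
apply: (@smooth_on_coind _ P (@open_gt R 0)); last first.
  by exists 1, a; apply/funext => x; rewrite mul1r.
move=> _ [c [b ->]]; exists (fun x => c * b * x `^ (b - 1)).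
  by exists (c * b), (b - 1).
move=> x /= x0; rewrite -mulrA.
by apply: (@is_deriveZ _ _ _ (fun y => y `^ b) c); exact: is_derive1_powR.
Qed.

(** Bootstrapping: the compositions [G \o V] with [G] smooth form a stable class, since their
    derivatives are [(G' F) \o V]. *)
Lemma smooth_on_ode D F V : open D -> smooth_on D F -> (forall t, D (V t)) ->
  (forall t : R, is_derive t 1 V (F (V t))) -> smooth_on setT V.
Proof.
move=> oD sF DV dV.
pose P (h : R -> R) := exists2 G, smooth_on D G & h = G \o V.
apply: (@smooth_on_coind _ P openT); last first.
  by exists id; first exact: smooth_on_id.
move=> _ [G sG ->]; exists (fun t => derive1 G (V t) * F (V t)).
  exists (fun x => derive1 G x * F x) => [|//].
  by apply: (smooth_onM oD _ sF); exact: smooth_on_derive1.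
move=> t _; apply: (is_derive1_comp _ (dV t)).
exact: smooth_on_is_derive sG (DV t).
Qed.

End smooth.

(** The two chord slopes are values of [dg] at points [x < y], and [dg] increases. Cross-multiplying
    the slopes avoids quotients and leaves products that simplify when [g] vanishes at some of the
    points. *)
Lemma convex_chord (R : realType) (g dg ddg : R -> R) (a b c : R) :
  (forall x : R, 0 < x -> is_derive x 1 g (dg x)) ->
  (forall x : R, 0 < x -> is_derive x 1 dg (ddg x)) ->
  (forall x : R, 0 < x -> 0 < ddg x) -> 0 < a -> a < b -> b < c ->
  (g b - g a) * (c - b) < (g c - g b) * (b - a).
Proof.
move=> dgE ddgE ddg0 a0 ab bc.
have [x xab ->] : exists2 x, a < x < b & g b - g a = dg x * (b - a).
  by apply: is_derive_mean_value => // x xab; apply: dgE; lra.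
have [y ybc ->] : exists2 y, b < y < c & g c - g b = dg y * (c - b).
  by apply: is_derive_mean_value => // y ybc; apply: dgE; lra.
have xy : x < y by lra.
have [z zxy dxy] : exists2 z, x < z < y & dg y - dg x = ddg z * (y - x).
  by apply: is_derive_mean_value => // z zxy; apply: ddgE; lra.
rewrite mulrAC ltr_pM2r ?subr_gt0// ltr_pM2r ?subr_gt0//.
by rewrite -subr_gt0 dxy mulr_gt0 ?subr_gt0//; apply: ddg0; lra.
Qed.

(** * Barriers and attraction for scalar autonomous equations *)

(** If [Y] exceeded [c] at time [t], there would be a last time [tau] before [t] with [Y tau <= c].
    There [Y tau = c], and the difference quotients from the right are nonnegative, against
    [F c < 0]. *)
Lemma autonomous_barrier (R : realType) (Y F : R -> R) (c a t : R) :
  (forall t : R, is_derive t 1 Y (F (Y t))) -> F c < 0 -> Y a <= c -> a <= t ->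
  Y t <= c.
Proof.
move=> dY Fc Yac a_le_t; rewrite leNgt; apply/negP => cYt.
have cY : continuous Y by move=> x; exact: is_derive_continuous (dY x).
pose E := `[a, t]%classic `&` Y @^-1` [set y | y <= c].
have cE : compact E.
  apply: compact_closedI; first exact: segment_compact.
  by apply: closed_comp => [x _|]; [exact: cY|exact: closed_le].
have E0 : E !=set0 by exists a; split => //=; rewrite in_itv/= lexx.
have cid : {within E, continuous (id : R -> R)}.
  by apply: continuous_subspaceT => x; exact: cvg_id.
have [/= tau] := compact_EVT_max E0 cE cid.
rewrite inE => -[/=]; rewrite in_itv/= => /andP[a_le_tau tau_le_t] Ytau tau_max.
have tau_lt_t : tau < t.
  by rewrite lt_neqAle tau_le_t andbT; apply: contraTneq Ytau => ->; rewrite -ltNge.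
have Yc : \forall x \near tau^'+, c <= Y x.
  near=> x; rewrite leNgt; apply/negP => Yxc.
  have : x <= tau.
    apply: tau_max; rewrite inE; split => /=; last exact: ltW.
    rewrite in_itv/=; apply/andP; split.
      by rewrite (le_trans a_le_tau)// ltW//; near: x; exact: nbhs_right_gt.
    by near: x; apply: nbhs_right_ltW.
  by rewrite leNgt => /negP; apply; near: x; exact: nbhs_right_gt.
have Ytauc : Y tau = c.
  apply/eqP; rewrite eq_le Ytau /=.
  by apply: (cvgr_to_ge _ Yc); apply: cvg_at_right_filter; exact: cY.
have [Ycvg dYtau] := dY tau.
have : 0 <= F (Y tau).
  rewrite -dYtau.
  apply: (@cvgr_to_ge _ (0^'+) _ _ (fun h => h^-1 *: ((Y \o shift tau) (h *: 1) - Y tau))).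
    exact: cvg_dnbhs_at_right Ycvg.
  move/nbhs_right0P : Yc => Yc; near=> h.
  rewrite mulr_ge0// ?invr_ge0 // subr_ge0 Ytauc /= [_%:A]mulr1 addrC.
  by near: h.
by rewrite Ytauc leNgt Fc.
Unshelve. all: by end_near. Qed.

(** The barrier lemma for [- Y] keeps [Y] above [e - eps]. If [Y t] were above [e + eps], the
    barriers at [Y 0] and [e + eps] would confine [Y] to the region where it falls at rate at least
    [m]; by time [t] it would have dropped by at least [Y 0 - e], a contradiction. *)
Lemma autonomous_attraction (R : realType) (Y F : R -> R) (e eps m t : R) :
  (forall t : R, is_derive t 1 Y (F (Y t))) -> 0 < eps -> 0 < m ->
  e + eps <= Y 0 -> 0 < F (e - eps) ->
  (forall y, e + eps <= y <= Y 0 -> F y <= - m) ->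
  (Y 0 - e) / m <= t -> `|Y t - e| <= eps.
Proof.
move=> dY eps0 m0 eY0 Flo Fhi tlarge.
have t0 : 0 < t by apply: lt_le_trans tlarge; rewrite divr_gt0//; lra.
have lo : - Y t <= - (e - eps).
  apply: (@autonomous_barrier _ (fun s => - Y s) (fun y => - F (- y)) _ 0).
  - by move=> s; rewrite opprK; apply: is_deriveN; exact: dY.
  - by rewrite opprK oppr_lt0.
  - by lra.
  - exact: ltW.
have Fneg y : e + eps <= y <= Y 0 -> F y < 0.
  by move/Fhi => /le_lt_trans; apply; rewrite oppr_lt0.
have Fe : F (e + eps) < 0 by apply: Fneg; lra.
have F0 : F (Y 0) < 0 by apply: Fneg; lra.
suff : Y t <= e + eps by move=> ?; rewrite ler_distlC; lra.
rewrite leNgt; apply/negP => Ythi.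
have [s s0t EY] : exists2 s, 0 < s < t & Y t - Y 0 = F (Y s) * (t - 0).
  by apply: (is_derive_mean_value t0) => x _; exact: dY.
have Ys0 : Y s <= Y 0 by apply: (autonomous_barrier dY F0 (lexx _)); lra.
have Yse : e + eps <= Y s.
  rewrite leNgt; apply/negP => Yse.
  have : Y t <= e + eps.
    by apply: (autonomous_barrier dY Fe (ltW Yse)); lra.
  by rewrite leNgt Ythi.
have FYs : F (Y s) <= - m by apply: Fhi; rewrite Yse Ys0.
have : F (Y s) * t <= - m * t by rewrite ler_pM2r.
move: tlarge; rewrite ler_pdivrMr// => ? ?.
by move: EY; rewrite subr0 => EY; lra.
Qed.

(** * Global solvability of scalar autonomous equations *)

Lemma continuous_antiderivative (R : realType) (f : R -> R) :
  continuous f -> exists A : R -> R, forall x : R, is_derive x 1 A (f x).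
Proof.
move=> cf.
pose F (M x : R) := (\int[lebesgue_measure]_(t in [set` `[- M, x]]) f t)%R.
have dF (M x : R) : - M < x -> is_derive x 1 (F M) (f x).
  move=> Mx; have xx1 : x < x + 1 by rewrite ltrDl.
  have [|dFx Fx] := continuous_FTC1_closed xx1 _ Mx (cf x).
    apply: continuous_compact_integrable; first exact: segment_compact.
    exact: continuous_subspaceT.
  by split; rewrite -?derive1E.
(* The integral from [- M] is a primitive only to the right of [- M]. Normalised to vanish at 0, the
   primitives for different [M] agree wherever both are valid, so they glue to one on the whole
   line. *)
have FE (M N y : R) : `|y| < M -> `|y| < N -> F M y - F M 0 = F N y - F N 0.
  move=> yM yN; pose D x := F M x - F N x.
  have dD x : - M < x -> - N < x -> is_derive x 1 D (f x - f x).
    by move=> Mx Nx; apply: is_deriveB; exact: dF.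
  suff : D y = D 0 by rewrite /D; lra.
  move: yM yN; rewrite !ltr_norml => yM yN.
  have [y0|y0|->//] := ltgtP y 0.
    have [x yx|c _] := @is_derive_mean_value _ D (fun x => f x - f x) _ _ y0.
      by apply: dD; lra.
    by rewrite subrr mul0r => /eqP; rewrite subr_eq0 => /eqP.
  have [x yx|c _] := @is_derive_mean_value _ D (fun x => f x - f x) _ _ y0.
    by apply: dD; lra.
  by rewrite subrr mul0r => /eqP; rewrite subr_eq0 => /eqP.
exists (fun x => F (`|x| + 1) x - F (`|x| + 1) 0) => x.
(* Near [x] the endpoint, which varies with the argument, may be frozen at its value for [x]. *)
apply: (@near_eq_is_derive _ _ _ (fun y => F (`|x| + 1) y - F (`|x| + 1) 0)).
  near=> y; apply: FE; last by rewrite ltrDl.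
  near: y.
  have : {for x, continuous (fun y : R => `|y|)} by exact: norm_continuous.
  by move=> /cvgr_lt; apply; rewrite ltrDl.
rewrite -[f x]subr0; apply: is_deriveB.
by apply: dF; move: (ler_norm (- x)); rewrite normrN; lra.
Unshelve. all: by end_near. Qed.

(* The solution is the inverse function of an antiderivative of 1 / phi; the upper
   bound on phi makes this antiderivative surjective. *)
Lemma autonomous_ode_exists (R : realType) (phi : R -> R) (K y0 : R) :
  continuous phi -> (forall y, 0 < phi y <= K) ->
  exists2 Y : R -> R, Y 0 = y0 & forall t : R, is_derive t 1 Y (phi (Y t)).
Proof.
move=> cphi phiK.
have phi0 y : 0 < phi y by case/andP: (phiK y).
have K0 : 0 < K by case/andP: (phiK 0) => /lt_le_trans; apply.
have [B dB] : exists A : R -> R, forall x : R, is_derive x 1 A (phi x)^-1.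
  apply: continuous_antiderivative => x.
  by apply: continuousV; [rewrite gt_eqF|exact: cphi].
pose A x := B x - B y0.
have dA (x : R) : is_derive x 1 A (phi x)^-1.
  by rewrite -[_^-1]subr0; apply: is_deriveB; exact: dB.
have Ay0 : A y0 = 0 by rewrite /A subrr.
have cA : continuous A by move=> x; exact: is_derive_continuous (dA x).
(* Growth at least linear gives both injectivity and, through the intermediate value theorem,
   surjectivity. *)
have Agrow x y : x < y -> (y - x) / K <= A y - A x.
  move=> xy; have [c _ ->] := is_derive_mean_value xy (fun z _ => dA z).
  rewrite mulrC ler_pM2r ?subr_gt0// lef_pV2 ?posrE//.
  by case/andP: (phiK c).
have Ainj : injective A.
  move=> x y AE; apply/eqP; rewrite eq_le !leNgt; apply/andP; split; apply/negP.
    move=> yx; have := Agrow _ _ yx; rewrite AE subrr leNgt divr_gt0//.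
    by rewrite subr_gt0.
  move=> yx; have := Agrow _ _ yx; rewrite AE subrr leNgt divr_gt0//.
  by rewrite subr_gt0.
have Asurj t : exists y, A y = t.
  (* With this radius, the growth bound places [t] between [A (y0 - r)] and [A (y0 + r)]. *)
  pose r := K * (`|t| + 1).
  have r0 : 0 < r by rewrite mulr_gt0// ltr_wpDl.
  have rK : r / K = `|t| + 1 by rewrite /r mulrC mulKf// gt_eqF.
  have hi : `|t| + 1 <= A (y0 + r).
    have := Agrow y0 (y0 + r); rewrite ltrDl => /(_ r0).
    by rewrite Ay0 subr0 addrAC subrr add0r rK.
  have lo : A (y0 - r) <= - (`|t| + 1).
    have := Agrow (y0 - r) y0; rewrite ltrBlDr ltrDl => /(_ r0).
    by rewrite Ay0 opprB addrCA subrr addr0 rK sub0r; lra.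
  have ht : - `|t| <= t <= `|t| by rewrite -ler_norml.
  have [|||y _ <-] := @IVT R A (y0 - r) (y0 + r) t; last by exists y.
  - by lra.
  - exact: continuous_subspaceT.
  - by rewrite min_l ?max_r; lra.
have [Y AY] := choice Asurj.
have YA : cancel A Y by move=> x; apply: Ainj; rewrite AY.
exists Y; first by rewrite -Ay0 YA.
move=> t; suff : is_derive (A (Y t)) 1 Y (phi (Y t)) by rewrite AY.
rewrite -[phi _]invrK; apply: (@is_derive_inverse _ A).
- by near=> x; exact: YA.
- by near=> x; exact: cA.
- by rewrite invr_eq0 gt_eqF.
Unshelve. all: by end_near. Qed.

(* In the coordinate y with w = logistic a b y, a field vanishing at most linearly
   at a and b becomes bounded on the whole line, so that the solution is global. *)
Definition logistic (R : realType) (a b y : R) : R :=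
  a + (b - a) / (1 + expR (- y)).

Lemma logistic_itv (R : realType) (a b y : R) : a < b -> a < logistic a b y < b.
Proof.
move=> ab; have e0 := expR_gt0 (- y); have e1 : 0 < 1 + expR (- y) by lra.
rewrite /logistic ltrDl divr_gt0//= ?subr_gt0//.
by rewrite -ltrBrDl ltr_pdivrMr// mulrDr mulr1 ltrDl mulr_gt0// subr_gt0.
Qed.

Lemma is_derive_logistic (R : realType) (a b y : R) : a < b ->
  is_derive y 1 (logistic a b)
    ((logistic a b y - a) * (b - logistic a b y) / (b - a)).
Proof.
move=> ab; have e0 := expR_gt0 (- y); have e1 : 1 + expR (- y) != 0 by lra.
have dE : is_derive y 1 (expR \o -%R) (expR (- y) * - 1).
  exact: is_derive1_comp.
have dD := @is_deriveD _ _ _ (cst (1 : R)) _ y 1 _ _ (is_derive_cst _ _ _) dE.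
have dV := @is_deriveV _ (cst (1 : R) + (expR \o -%R)) y _ 1 e1 dD.
have dM := @is_deriveZ _ _ _ _ (b - a) y 1 _ dV.
have dS := @is_deriveD _ _ _ (cst a) _ y 1 _ _ (is_derive_cst _ _ _) dM.
apply: (is_derive_eq dS).
rewrite /logistic /GRing.scale/= !fctE/=; field; lra.
Qed.

Lemma logistic_logit (R : realType) (a b c : R) : a < c < b ->
  logistic a b (ln ((c - a) / (b - c))) = c.
Proof.
move=> acb; rewrite /logistic expRN lnK ?posrE ?divr_gt0//; try lra.
field; lra.
Qed.

Lemma equilibria_ode_exists (R : realType) (f : R -> R) (a b c K : R) :
  a < c < b -> (forall x, a < x < b -> {for x, continuous f}) ->
  (forall x, a < x < b -> 0 < - f x <= K * ((x - a) * (b - x))) ->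
  exists V : R -> R, [/\ V 0 = c, forall t, a < V t < b &
    forall t : R, is_derive t 1 V (f (V t))].
Proof.
move=> acb cf fK; have ab : a < b by lra.
pose w := logistic a b; have wab y : a < w y < b by exact: logistic_itv.
have dw (y : R) : is_derive y 1 w ((w y - a) * (b - w y) / (b - a)).
  exact: is_derive_logistic.
have w0 y : 0 < (w y - a) * (b - w y).
  by have := wab y; move=> /andP[? ?]; rewrite mulr_gt0// subr_gt0.
(* This is [- f] divided by the derivative of [w]. The sign makes it positive, as the existence
   lemma for bounded fields requires; the time reversal in the solution undoes it. *)
pose phi y := - f (w y) * (b - a) / ((w y - a) * (b - w y)).
have cw : continuous w by move=> y; exact: is_derive_continuous (dw y).
have cphi : continuous phi.
  move=> y; have cfw : {for y, continuous (f \o w)}.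
    by apply: continuous_comp; [exact: cw|exact: cf].
  have cq : {for y, continuous (fun y => (w y - a) * (b - w y))}.
    by apply: cvgM; apply: cvgB; (try exact: cw); exact: cvg_cst.
  apply: (cvgM (cvgM (cvgN cfw) (cvg_cst _)) (cvgV _ cq)).
  by rewrite gt_eqF.
have phiK y : 0 < phi y <= K * (b - a).
  have /andP[f0 fle] := fK _ (wab y).
  rewrite divr_gt0//= ?mulr_gt0 ?subr_gt0//.
  by rewrite ler_pdivrMr// mulrAC ler_pM2r// subr_gt0.
have [Y Y0 dY] := autonomous_ode_exists (ln ((c - a) / (b - c))) cphi phiK.
exists (fun t => w (Y (- t))); split => [|t|t].
- by rewrite oppr0 Y0 /w logistic_logit.
- exact: wab.
- have dYN : is_derive t 1 (Y \o -%R) (phi (Y (- t)) * - 1).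
    by apply: is_derive1_comp; exact: dY.
  apply: (is_derive_eq (is_derive1_comp (dw (Y (- t))) dYN)); rewrite /phi.
  by have := wab (Y (- t)); move: (w _) => z zab; field; lra.
Qed.

(** * Travelling waves *)

(** A directional derivative is the derivative at 0 of the restriction to a line; this reduces
    partial derivatives to one-variable calculus. *)
Lemma is_derive_along (R : realType) (V : normedModType R) (f : V -> R) (z v : V)
    (df : R) :
  is_derive (0 : R) 1 (fun h : R => f (h *: v + z)) df -> is_derive z v f df.
Proof.
case=> df0 dfE; split; first exact/derivable1P.
rewrite -dfE /derive.
set q1 := (X in X @ _); set q2 := (X in _ = lim (X @ _)).
suff -> : q1 = q2 by [].
apply/funext => h; rewrite /q1 /q2 /=.
by rewrite addr0 scale0r add0r [_%:A]mulr1.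
Qed.

Lemma is_derive_affine (R : realType) (F : R -> R) (k c x dF : R) :
  is_derive (k * x + c) 1 F dF ->
  is_derive x 1 (fun x => F (k * x + c)) (dF * k).
Proof.
move=> dFE; apply: (@is_derive1_comp _ F (fun x => k * x + c)) => //.
have dk := @is_deriveZ _ _ _ id k x 1 _ (is_derive_id _ _).
apply: (is_derive_eq (is_deriveD dk (is_derive_cst c _ _))).
by rewrite addr0 [_ *: _]mulr1.
Qed.

Section travelling_wave.
Context {R : realType}.
Variables (s alpha : R).
Implicit Types (F : R -> R) (z : R * R).

Lemma is_derive_wave_x F z dF : is_derive ((z.1 - s * z.2) / alpha) 1 F dF ->
  is_derive z ((1, 0) : R * R) (travelling_wave s alpha F) (dF / alpha).
Proof.
move=> dFE; apply: is_derive_along.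
rewrite [X in is_derive _ _ X](_ : _ =
    fun h => F (alpha^-1 * h + (z.1 - s * z.2) / alpha)); last first.
  apply/funext => h; rewrite /travelling_wave /= [_%:A]mulr1 scaler0 add0r.
  by congr F; rewrite -addrA mulrDl [h / _]mulrC.
by apply: is_derive_affine; rewrite mulr0 add0r.
Qed.

Lemma is_derive_wave_t F z dF : is_derive ((z.1 - s * z.2) / alpha) 1 F dF ->
  is_derive z ((0, 1) : R * R) (travelling_wave s alpha F) (dF * (- s / alpha)).
Proof.
move=> dFE; apply: is_derive_along.
rewrite [X in is_derive _ _ X](_ : _ =
    fun h => F (- s / alpha * h + (z.1 - s * z.2) / alpha)); last first.
  apply/funext => h; rewrite /travelling_wave /= [_%:A]mulr1 scaler0 add0r.
  by congr F; ring.
by apply: is_derive_affine; rewrite mulr0 add0r.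
Qed.

Lemma Dx_wave F z : derivable F ((z.1 - s * z.2) / alpha) 1 ->
  Dx (travelling_wave s alpha F) z =
  travelling_wave s alpha (derive1 F) z / alpha.
Proof.
by move=> /derivableP/is_derive_wave_x[_ dF]; rewrite /Dx dF -derive1E.
Qed.

Lemma Dt_wave F z : derivable F ((z.1 - s * z.2) / alpha) 1 ->
  Dt (travelling_wave s alpha F) z =
  travelling_wave s alpha (derive1 F) z * (- s / alpha).
Proof.
by move=> /derivableP/is_derive_wave_t[_ dF]; rewrite /Dt dF -derive1E.
Qed.

(** Both partial derivatives of a wave are again waves, whose profiles are constant multiples of the
    derivative of [F], so the induction on [k] closes. *)
Lemma Ck_on_wave k F : smooth_on setT F -> Ck_on k setT (travelling_wave s alpha F).
Proof.
elim: k F => [|k IH] F sF; have dF x : derivable F x 1 by exact: (sF 0%N).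
  move=> z _; apply: (@continuous_comp _ _ _ (fun z : R * R => (z.1 - s * z.2) / alpha) F).
    apply: cvgM; last exact: cvg_cst.
    apply: cvgB; first exact: cvg_fst.
    by apply: cvgM; [exact: cvg_cst|exact: cvg_snd].
  exact/differentiable_continuous/derivable1_diffP.
have sFM c : smooth_on setT (fun x => derive1 F x * c).
  apply: (smooth_onM openT); first exact: smooth_on_derive1.
  exact/smooth_on_cst/openT.
split=> [z _|z _||].
- by have /derivableP/is_derive_wave_x[] := dF ((z.1 - s * z.2) / alpha).
- by have /derivableP/is_derive_wave_t[] := dF ((z.1 - s * z.2) / alpha).
- rewrite (_ : Dx _ = travelling_wave s alpha (fun x => derive1 F x * alpha^-1)).
    exact: IH.
  by apply/funext => z; rewrite Dx_wave.
- rewrite (_ : Dt _ = travelling_wave s alpha (fun x => derive1 F x * (- s / alpha))).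
    exact: IH.
  by apply/funext => z; rewrite Dt_wave.
Qed.

Lemma smooth2_on_wave D F : smooth_on setT F -> smooth2_on D (travelling_wave s alpha F).
Proof. by move=> sF; exists setT; split => // [|k]; [exact: openT|exact: Ck_on_wave]. Qed.

End travelling_wave.

Lemma profile_flux_derivable (R : realType) (V U : R -> R) (b x : R) :
  smooth_on setT V -> smooth_on setT U -> 0 < V x ->
  derivable (fun y => derive1 U y / V y `^ b) x 1.
Proof.
move=> sV sU Vx.
have dU := smooth_on_is_derive (smooth_on_derive1 sU) (I : setT x).
have dV := smooth_on_is_derive sV (I : setT x).
have dP := is_derive1_comp (is_derive1_powR (- b) Vx) dV.
rewrite (_ : (fun y => _) = (fun y => derive1 U y * (@powR R ^~ (- b) \o V) y)).
  by have [] := is_deriveM dU dP.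
by apply/funext => y /=; rewrite powRN.
Qed.

(** Each derivative of a wave brings a factor [1 / alpha], and the viscous term has two of them
    against one factor [alpha]. Both equations are therefore the profile equations divided by
    [alpha]. *)
Lemma wave_navier_stokes (R : realType) (p : R -> R) (vm um vp up s alpha : R)
    (V U : R -> R) :
  smooth_on [set v | 0 < v] p -> 0 < alpha ->
  viscous_shock_profile p vm um vp up s alpha V U ->
  navier_stokes_solution p alpha
    (fun x => travelling_wave s alpha V (x, 0))
    (fun x => travelling_wave s alpha U (x, 0))
    (travelling_wave s alpha V) (travelling_wave s alpha U).
Proof.
move=> sp alpha0 [sV sU V0 mass momentum _ _ _ _ _].
have dV x : derivable V x 1 by exact: (sV 0%N).
have dU x : derivable U x 1 by exact: (sU 0%N).
split=> //.
- exact: smooth2_on_wave.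
- exact: smooth2_on_wave.
- by move=> x t _; exact: V0.
- move=> x t _; rewrite Dt_wave// Dx_wave// /travelling_wave /=.
  have := mass ((x - s * t) / alpha).
  by move/eqP; rewrite subr_eq0 => /eqP <-; field; lra.
- move=> x t _; rewrite Dt_wave//.
  pose q xi := derive1 U xi / V xi `^ (1 + alpha).
  have dq y : derivable q y 1 by exact: profile_flux_derivable.
  have -> : (fun z => Dx (travelling_wave s alpha U) z /
      travelling_wave s alpha V z `^ (1 + alpha)) =
      travelling_wave s alpha (fun xi => q xi * alpha^-1).
    by apply/funext => z; rewrite Dx_wave// /travelling_wave /q mulrAC.
  have dpV : derivable (p \o V) ((x - s * t) / alpha) 1.
    have dp := smooth_on_is_derive sp (V0 ((x - s * t) / alpha)).
    by have [] := is_derive1_comp dp (smooth_on_is_derive sV (I : setT _)).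
  rewrite (@Dx_wave _ s alpha (p \o V))//.
  rewrite Dx_wave; last by apply: derivableM => //; exact: derivable_cst.
  rewrite /travelling_wave /= derive1Mr// -momentum.
  by field; lra.
Qed.

Lemma Linfty_norm_le (R : realType) (Omega : set (R * R)) (f g : R * R -> R) (M : R) :
  0 <= M -> (forall z, Omega z -> `|f z| <= M /\ `|g z| <= M) ->
  (Linfty_norm Omega f g <= M%:E)%E.
Proof.
(* At exponent [+oo] the norm is an essential supremum if the whole space has positive measure and 0
   otherwise; the second case is closed by [0 <= M]. *)
move=> M0 fgM; rewrite /Linfty_norm unlock; case: ifPn => _; last by rewrite lee_fin.
apply/ess_supP; apply/aeW => z /=.
rewrite lee_fin patchE; case: ifPn => [|_]; last by rewrite normr0.
rewrite inE => /fgM[fM gM].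
by rewrite normr_id prod_normE ge_max fM gM.
Qed.

(** * Shock profiles *)

Section hugoniot.
Context {R : realType}.
Variables (p : R -> R) (vp vm s : R).
Hypotheses (p_smooth : smooth_on [set v | 0 < v] p)
  (p_convex : forall v, 0 < v -> 0 < derive1n 2 p v)
  (vp_gt0 : 0 < vp) (vp_lt_vm : vp < vm) (s_lt0 : s < 0).

(** The height of the graph of [p] above the Rayleigh line, which has slope [- s ^+ 2] and passes
    through the right state. *)
Definition hugoniot v := s ^+ 2 * (v - vp) + (p v - p vp).

Hypothesis hugoniot_vm : hugoniot vm = 0.

Lemma hugoniot_vp : hugoniot vp = 0.
Proof. by rewrite /hugoniot !subrr mulr0 addr0. Qed.

Lemma smooth_on_hugoniot : smooth_on [set v | 0 < v] hugoniot.
Proof.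
have o0 : open [set v : R | 0 < v] by exact: open_gt.
have sc c : smooth_on [set v : R | 0 < v] (fun=> c) by exact: smooth_on_cst.
apply: smooth_onD => //; last exact: smooth_onD.
apply: smooth_onM => //.
by apply: smooth_onD => //; exact: smooth_on_id.
Qed.

Lemma is_derive_hugoniot (v : R) : 0 < v ->
  is_derive v 1 hugoniot (s ^+ 2 + derive1 p v).
Proof.
move=> v0; have dp := smooth_on_is_derive p_smooth v0.
have dl := is_deriveB (is_derive_id v 1) (is_derive_cst vp v 1).
have dq := is_deriveB dp (is_derive_cst (p vp) v 1).
apply: (is_derive_eq (is_deriveD (is_deriveZ (s ^+ 2) dl) dq)).
by rewrite !subr0 [_ *: _]mulr1.
Qed.

Lemma hugoniot_chord a b c : 0 < a -> a < b -> b < c ->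
  (hugoniot b - hugoniot a) * (c - b) < (hugoniot c - hugoniot b) * (b - a).
Proof.
apply: (convex_chord is_derive_hugoniot _ p_convex) => v v0.
have dp := smooth_on_is_derive (smooth_on_derive1 p_smooth) v0.
by apply: (is_derive_eq (is_deriveD (is_derive_cst (s ^+ 2) v 1) dp)); rewrite add0r.
Qed.

(** With zeros at two of the three points, the chord inequality reduces to the sign of
    [hugoniot v * (vm - vp)]. *)
Lemma hugoniot_lt0 v : vp < v < vm -> hugoniot v < 0.
Proof.
have vp0 := vp_gt0; have vpvm := vp_lt_vm.
move=> /andP[vpv vvm]; have := hugoniot_chord vp_gt0 vpv vvm.
rewrite hugoniot_vp hugoniot_vm => gv.
have : hugoniot v * (vm - vp) < 0 by lra.
by rewrite pmulr_llt0// subr_gt0.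
Qed.

Lemma hugoniot_gt0 v : 0 < v < vp \/ vm < v -> 0 < hugoniot v.
Proof.
have vp0 := vp_gt0; have vpvm := vp_lt_vm.
case=> [/andP[v0 vvp]|vmv].
  have := hugoniot_chord v0 vvp vp_lt_vm.
  rewrite hugoniot_vp hugoniot_vm => gv.
  have : 0 < hugoniot v * (vm - vp) by lra.
  by rewrite pmulr_lgt0// subr_gt0.
have := hugoniot_chord vp_gt0 vp_lt_vm vmv.
rewrite hugoniot_vp hugoniot_vm => gv.
have : 0 < hugoniot v * (vm - vp) by lra.
by rewrite pmulr_lgt0// subr_gt0.
Qed.

(** Chords ending at the outer points [vp / 2] and [vm + 1] bound [- hugoniot] linearly at [vp] and
    at [vm]. Every [v] is at distance at least [d], half the width, from one end; the linear bound
    at the other end then yields the product bound. *)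
Lemma hugoniot_bound :
  exists K, forall v, vp < v < vm -> - hugoniot v <= K * ((v - vp) * (vm - v)).
Proof.
have vp0 := vp_gt0; have vpvm := vp_lt_vm.
have [d dE] : exists d, d = (vm - vp) / 2 by eexists.
pose Kl := hugoniot (vp / 2) / (vp / 2).
pose Kr := hugoniot (vm + 1).
have vp20 : 0 < vp / 2 by lra.
have Kl0 : 0 < Kl by rewrite divr_gt0// hugoniot_gt0//; left; lra.
have Kr0 : 0 < Kr by apply: hugoniot_gt0; right; lra.
exists ((Kl + Kr) / d) => v vI.
have lo : - hugoniot v <= Kl * (v - vp).
  rewrite /Kl mulrAC ler_pdivlMr; last by lra.
  have /andP[vpv _] := vI.
  have := @hugoniot_chord (vp / 2) _ _ _ _ vpv; rewrite hugoniot_vp.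
  by lra.
have hi : - hugoniot v <= Kr * (vm - v).
  have /andP[_ vvm] := vI.
  have := @hugoniot_chord v vm (vm + 1); rewrite hugoniot_vm -/Kr.
  by lra.
have d0 : 0 < d by lra.
clearbody Kl Kr.
rewrite mulrAC ler_pdivlMr//.
have [vmid|vmid] := leP d (v - vp).
  have : - hugoniot v * d <= Kr * (vm - v) * (v - vp).
    apply: ler_pM => //; [|by lra].
    by have := hugoniot_lt0 vI; lra.
  have : 0 <= Kl * ((v - vp) * (vm - v)).
    by rewrite mulr_ge0 ?mulr_ge0//; lra.
  lra.
have : - hugoniot v * d <= Kl * (v - vp) * (vm - v).
  apply: ler_pM => //; [|by lra|by lra].
  by have := hugoniot_lt0 vI; lra.
have : 0 <= Kr * ((v - vp) * (vm - v)).
  by rewrite mulr_ge0 ?mulr_ge0//; lra.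
lra.
Qed.

Lemma hugoniot_gap a b : vp < a -> a <= b -> b < vm ->
  exists2 m, 0 < m & forall v, a <= v <= b -> hugoniot v <= - m.
Proof.
have vp0 := vp_gt0; have vpvm := vp_lt_vm.
move=> vpa ab bvm.
have [|c cab cmax] := EVT_max ab (f := hugoniot).
  apply: continuous_in_subspaceT => v; rewrite inE/= in_itv/= => vab.
  by apply: (is_derive_continuous (is_derive_hugoniot _)); lra.
exists (- hugoniot c); first by rewrite oppr_gt0 hugoniot_lt0//; move: cab; rewrite in_itv/=; lra.
by move=> v vab; rewrite opprK; apply: cmax.
Qed.

Definition profile_field alpha v := v `^ (1 + alpha) * hugoniot v / - s.

Lemma profile_field_lt0 alpha v : vp < v < vm -> profile_field alpha v < 0.
Proof.
have vp0 := vp_gt0; have vpvm := vp_lt_vm.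
move=> vI; rewrite pmulr_llt0 ?invr_gt0 ?oppr_gt0//.
rewrite pmulr_rlt0 ?hugoniot_lt0// powR_gt0//; lra.
Qed.

Lemma profile_field_gt0 alpha v : 0 < v < vp \/ vm < v -> 0 < profile_field alpha v.
Proof.
have vp0 := vp_gt0; have vpvm := vp_lt_vm.
move=> vI; rewrite divr_gt0 ?oppr_gt0// mulr_gt0 ?hugoniot_gt0// powR_gt0//.
by case: vI; lra.
Qed.

(** The linear vanishing at both equilibria that [equilibria_ode_exists] asks for. Here [K] may
    depend on [alpha], since it serves only the existence of a profile. *)
Lemma profile_field_bound alpha : 0 < alpha ->
  exists K, forall v, vp < v < vm ->
    0 < - profile_field alpha v <= K * ((v - vp) * (vm - v)).
Proof.
have vp0 := vp_gt0; have vpvm := vp_lt_vm.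
move=> alpha0; have [K hK] := hugoniot_bound.
exists (vm `^ (1 + alpha) * K / - s) => v vI.
rewrite oppr_gt0 profile_field_lt0//= /profile_field -mulNr -mulrN.
rewrite [leRHS]mulrAC ler_pM2r ?invr_gt0 ?oppr_gt0// -mulrA.
apply: ler_pM; rewrite ?powR_ge0 ?hK//.
  by rewrite oppr_ge0 ltW// hugoniot_lt0.
by apply: ge0_ler_powR; rewrite ?nnegrE; lra.
Qed.

(** The point is that [m] is chosen before [alpha], which later makes the transition time uniform in
    the viscosity. *)
Lemma profile_field_gap A a b : 0 < A -> vp < a -> a <= b -> b < vm ->
  exists2 m, 0 < m & forall alpha v, 0 < alpha <= A -> a <= v <= b ->
    profile_field alpha v <= - m.
Proof.
have vp0 := vp_gt0; have vpvm := vp_lt_vm.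
move=> A0 vpa ab bvm; have [m m0 hm] := hugoniot_gap vpa ab bvm.
pose w := Num.min 1 vp.
have w0 : 0 < w by rewrite lt_min ltr01 vp_gt0.
have w1 : w <= 1 by rewrite ge_min lexx.
have wvp : w <= vp by rewrite ge_min lexx orbT.
exists (w `^ (1 + A) * m / - s).
  by rewrite divr_gt0 ?oppr_gt0// mulr_gt0// powR_gt0.
move=> alpha v alphaA vab.
rewrite /profile_field -mulNr ler_pM2r ?invr_gt0 ?oppr_gt0//.
rewrite lerNr -mulrN; apply: ler_pM; rewrite ?powR_ge0//; first exact: ltW.
  apply: (@le_trans _ _ (w `^ (1 + alpha))).
    by apply: ger_powR; [rewrite w0|lra].
  by apply: ge0_ler_powR; rewrite ?nnegrE; lra.
by rewrite lerNr hm.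
Qed.

Lemma smooth_on_profile_field alpha : smooth_on [set v | 0 < v] (profile_field alpha).
Proof.
have o0 : open [set v : R | 0 < v] by exact: open_gt.
apply: smooth_onM => //; last exact: smooth_on_cst.
by apply: smooth_onM => //; [exact: smooth_on_powR|exact: smooth_on_hugoniot].
Qed.

(* T does not depend on alpha. Near vm one applies the attraction to - V (- t). *)
Lemma profile_field_attraction A eps : 0 < A -> 0 < eps ->
  exists2 T, 0 < T & forall alpha V, 0 < alpha <= A -> V 0 = (vm + vp) / 2 ->
    (forall t : R, is_derive t 1 V (profile_field alpha (V t))) ->
    (forall t, T <= t -> `|V t - vp| <= eps) /\
    (forall t, t <= - T -> `|V t - vm| <= eps).
Proof.
have vp0 := vp_gt0; have vpvm := vp_lt_vm.
move=> A0 eps0.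
(* The quarter width keeps the midpoint within [[vp + e, vm - e]]; the bound [vp / 2] keeps [vp - e]
   positive, where the sign of the field is known. *)
pose e := Num.min eps (Num.min ((vm - vp) / 4) (vp / 2)).
have e0 : 0 < e by rewrite !lt_min eps0; lra.
have eeps : e <= eps by rewrite ge_min lexx.
have evm : e <= (vm - vp) / 4 by rewrite !ge_min lexx orbT.
have evp : e <= vp / 2 by rewrite !ge_min lexx !orbT.
have [|||m m0 hm] := @profile_field_gap A (vp + e) (vm - e) A0; try by lra.
(* The time needed to cover the distance from the midpoint to either end state at speed [m]. *)
exists ((vm - vp) / 2 / m); first by rewrite !divr_gt0//; lra.
move=> alpha V alphaA V0 dV; split=> t tT; apply: le_trans eeps.
  apply: (autonomous_attraction dV e0 m0).
  - by rewrite V0; lra.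
  - by apply: profile_field_gt0; left; lra.
  - by move=> y yI; apply: hm => //; move: yI; rewrite V0; lra.
  - by apply: le_trans tT; rewrite V0 ler_pM2r ?invr_gt0//; lra.
rewrite -normrN opprB -[t]opprK addrC.
rewrite [X in `|X|](_ : _ = - V (- - t) - - vm); last by rewrite [- - vm]opprK.
apply: (@autonomous_attraction _ (fun t => - V (- t))
  (fun y => profile_field alpha (- y)) (- vm) e m (- t)) => //.
- move=> u; rewrite opprK.
  have dN := @is_derive1_comp _ V -%R u _ _ (dV (- u)) (is_deriveNid _ _).
  by apply: (is_derive_eq (is_deriveN dN)); rewrite mulrN1 opprK.
- by rewrite oppr0 V0; lra.
- by apply: profile_field_gt0; right; lra.
- by move=> y; rewrite oppr0 V0 => yI; apply: hm => //; lra.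
- rewrite lerNr; apply: (le_trans tT); rewrite lerN2 oppr0 V0.
  by rewrite ler_pM2r ?invr_gt0//; lra.
Qed.

End hugoniot.

(** On a far unit interval the increment of [f] is small, yet by the mean value theorem it is a
    value of [df], hence close to [L]. Taking [e] to be a third of [|L|] absorbs the three
    errors. *)
Lemma cvg_derive_eq0 (R : realType) (f df : R -> R) (l L : R) :
  (forall x : R, is_derive x 1 f (df x)) ->
  f x @[x --> +oo] --> l -> df x @[x --> +oo] --> L -> L = 0.
Proof.
move=> dfE /cvgrPdist_lt fl /cvgrPdist_lt dfL.
apply/eqP/negPn/negP => L0; pose e := `|L| / 3.
have e0 : 0 < e by rewrite divr_gt0// normr_gt0.
have [M [_ HM]] : \forall x \near +oo, `|l - f x| < e /\ `|L - df x| < e.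
  by near=> x; split; near: x; [exact: fl|exact: dfL].
have M12 : M + 1 < M + 2 by lra.
have [c cM E] := is_derive_mean_value M12 (fun x _ => dfE x).
have [f1 _] : `|l - f (M + 1)| < e /\ `|L - df (M + 1)| < e by apply: HM => /=; lra.
have [f2 _] : `|l - f (M + 2)| < e /\ `|L - df (M + 2)| < e by apply: HM => /=; lra.
have [_ dc] : `|l - f c| < e /\ `|L - df c| < e by apply: HM => /=; lra.
have L3 : `|L| = 3 * e by rewrite /e mulrC divfK.
move: f1 f2 dc E; rewrite !ltr_norml; clearbody e => f1 f2 dc E.
have : `|L| < 3 * e by rewrite ltr_norml; lra.
by rewrite L3 ltxx.
Unshelve. all: by end_near. Qed.

Lemma is_derive0_cvg (R : realType) (f : R -> R) (l : R) :
  (forall x : R, is_derive x 1 f 0) -> f x @[x --> +oo] --> l -> f = cst l.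
Proof.
move=> df fl; apply/funext => x; apply/eqP; rewrite eq_le; apply/andP; split.
  by apply: (cvgr_to_ge fl); near=> y; rewrite (is_derive_0_is_cst x y df).
by apply: (cvgr_to_le fl); near=> y; rewrite (is_derive_0_is_cst x y df).
Unshelve. all: by end_near. Qed.

(** * Existence of profiles and the scalar equation that they satisfy *)

Section profile.
Context {R : realType}.
Variables (p : R -> R) (vm um vp up s : R).
Hypotheses (p_smooth : smooth_on [set v | 0 < v] p)
  (p_convex : forall v, 0 < v -> 0 < derive1n 2 p v)
  (vp_gt0 : 0 < vp) (vp_lt_vm : vp < vm) (s_lt0 : s < 0)
  (rh_mass : - s * (vp - vm) - (up - um) = 0)
  (rh_momentum : - s * (up - um) + (p vp - p vm) = 0).

Lemma hugoniot_left_state : hugoniot p vp s vm = 0.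
Proof.
have E1 := rh_mass; have E2 := rh_momentum.
have upE : up - um = - s * (vp - vm) by lra.
by move: E2; rewrite upE /hugoniot => E2; lra.
Qed.

Lemma profile_exists alpha : 0 < alpha ->
  exists V U, viscous_shock_profile p vm um vp up s alpha V U.
Proof.
move=> alpha0; have hvm := hugoniot_left_state.
have vp0 := vp_gt0; have vpvm := vp_lt_vm; have s0 := s_lt0.
pose f := profile_field p vp s alpha.
have sf : smooth_on [set v | 0 < v] f by exact: smooth_on_profile_field.
have [K fK] := profile_field_bound p_smooth p_convex vp_gt0 vp_lt_vm s_lt0 hvm alpha0.
have [||V [V0 Vab dV]] := @equilibria_ode_exists _ f vp vm ((vm + vp) / 2) K _ _ fK.
- by lra.
- by move=> v vI; apply: (is_derive_continuous (smooth_on_is_derive sf _)) => /=; lra.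
have Vgt0 xi : 0 < V xi by have := Vab xi; lra.
have o0 : open [set v : R | 0 < v] by exact: open_gt.
have sV : smooth_on setT V := smooth_on_ode o0 sf Vgt0 dV.
(* The mass equation integrated, with the constant fixed by the right state; the left limit is then
   [um] by the first Rankine-Hugoniot condition. *)
pose U xi := up + - s * (V xi - vp).
have dU (xi : R) : is_derive xi 1 U (- s * f (V xi)).
  have dl := is_deriveB (dV xi) (is_derive_cst vp xi 1).
  apply: (is_derive_eq (is_deriveD (is_derive_cst up xi 1) (is_deriveZ (- s) dl))).
  by rewrite add0r subr0.
have V'E xi : derive1 V xi = f (V xi) by rewrite derive1E; have [] := dV xi.
have U'E xi : derive1 U xi = - s * f (V xi) by rewrite derive1E; have [] := dU xi.
have lim eps : 0 < eps -> exists2 T, 0 < T &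
    (forall t, T <= t -> `|V t - vp| <= eps) /\
    (forall t, t <= - T -> `|V t - vm| <= eps).
  move=> eps0.
  have [T T0 HT] := profile_field_attraction p_smooth p_convex vp_gt0 vp_lt_vm
    s_lt0 hvm alpha0 eps0.
  by exists T => //; apply: (HT alpha V) => //; rewrite alpha0 lexx.
have VNy : V xi @[xi --> -oo] --> vm.
  apply/cvgrPdist_le => eps /lim[T _ [_ HT]]; near=> t; rewrite distrC.
  by apply: HT; near: t; apply: nbhs_ninfty_le; exact: num_real.
have Vy : V xi @[xi --> +oo] --> vp.
  apply/cvgrPdist_le => eps /lim[T _ [HT _]]; near=> t; rewrite distrC.
  by apply: HT; near: t; apply: nbhs_pinfty_ge; exact: num_real.
exists V, U; split => //.
- apply: (smooth_onD openT); first exact/smooth_on_cst/openT.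
  apply: (smooth_onM openT); first exact/smooth_on_cst/openT.
  by apply: (smooth_onD openT) => //; exact/smooth_on_cst/openT.
- by move=> xi; rewrite V'E U'E subrr.
- move=> xi.
  (* Along this [V] the viscous flux is exactly the Hugoniot function, so the momentum equation
     follows by the chain rule. *)
  rewrite (_ : (fun eta => _) = hugoniot p vp s \o V); last first.
    apply/funext => eta; rewrite U'E /f /profile_field /=.
    by field; rewrite gt_eqF ?powR_gt0//=; lra.
  have dh := is_derive1_comp (is_derive_hugoniot vp s p_smooth (Vgt0 xi)) (dV xi).
  have dp := is_derive1_comp (smooth_on_is_derive p_smooth (Vgt0 xi)) (dV xi).
  rewrite U'E !derive1E; have [_ ->] := dh; have [_ ->] := dp.
  by ring.
- rewrite (_ : um = up + - s * (vm - vp)); last by have := rh_mass; lra.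
  by apply: cvgD; [exact: cvg_cst|apply: cvgMr; apply: cvgB => //; exact: cvg_cst].
- rewrite [X in _ --> X](_ : up = up + - s * (vp - vp)); last by lra.
  by apply: cvgD; [exact: cvg_cst|apply: cvgMr; apply: cvgB => //; exact: cvg_cst].
Unshelve. all: by end_near. Qed.

(** The converse of the construction: the limit concerns an arbitrary family of profiles, so each of
    them has to be reduced to the scalar equation. Both equations are integrated once, and the
    constants are found from the behaviour at [+oo]. *)
Lemma profile_ode alpha V U : viscous_shock_profile p vm um vp up s alpha V U ->
  (forall xi : R, is_derive xi 1 V (profile_field p vp s alpha (V xi))) /\
  (forall xi, U xi = up - s * (V xi - vp)).
Proof.
have s0 := s_lt0.
case=> sV sU Vgt0 mass momentum _ Vy _ Uy _.
have dV (xi : R) := smooth_on_is_derive sV (I : setT xi).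
have dU (xi : R) := smooth_on_is_derive sU (I : setT xi).
have UE xi : U xi = up - s * (V xi - vp).
  have dW (x : R) : is_derive x 1 (fun y => U y + s * V y) 0.
    apply: (is_derive_eq (is_deriveD (dU x) (is_deriveZ s (dV x)))).
    by have := mass x; rewrite /GRing.scale/=; lra.
  have Wy : U x + s * V x @[x --> +oo] --> up + s * vp.
    by apply: cvgD => //; exact: cvgMr.
  have /(congr1 (fun w => w xi)) := is_derive0_cvg dW Wy.
  by rewrite /=; lra.
split=> // xi.
pose q y := derive1 U y / V y `^ (1 + alpha).
have qE : q = fun y => hugoniot p vp s (V y).
  have dq (x : R) : is_derive x 1 q (derive1 q x).
    by rewrite derive1E; apply: derivableP; exact: profile_flux_derivable.
  pose d y := q y - hugoniot p vp s (V y).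
  have dd (x : R) : is_derive x 1 d 0.
    have dh := is_derive1_comp (is_derive_hugoniot vp s p_smooth (Vgt0 x)) (dV x).
    have dp := is_derive1_comp (smooth_on_is_derive p_smooth (Vgt0 x)) (dV x).
    apply: (is_derive_eq (is_deriveB (dq x) dh)).
    rewrite -momentum [derive1 (p \o V) x]derive1E; have [_ ->] := dp.
    have /eqP := mass x; rewrite subr_eq0 => /eqP <-.
    by ring.
  (* The integration constant k vanishes: U' has limit k vp^(1+alpha) at +oo while
     U converges. *)
  have [k dk] : exists k, d = cst k.
    by exists (d 0); apply/funext => x; exact: is_derive_0_is_cst dd.
  have hVy : hugoniot p vp s (V y) @[y --> +oo] --> (0 : R).
    rewrite -(hugoniot_vp p vp s); apply: (@cvg_comp _ _ _ V (hugoniot p vp s) _ _ _ Vy).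
    exact: is_derive_continuous (is_derive_hugoniot vp s p_smooth vp_gt0).
  have U'E y : derive1 U y = (hugoniot p vp s (V y) + k) * V y `^ (1 + alpha).
    have /(congr1 (fun w => w y)) := dk; rewrite /= /d /q => <-.
    by rewrite addrC subrK divfK// gt_eqF// powR_gt0.
  have U'y : derive1 U y @[y --> +oo] --> (0 + k) * vp `^ (1 + alpha).
    move/funext : U'E => ->.
    apply: cvgM; first by apply: cvgD => //; exact: cvg_cst.
    apply: (@cvg_comp _ _ _ V (@powR R ^~ (1 + alpha)) _ _ _ Vy).
    exact: (is_derive_continuous (is_derive1_powR (1 + alpha) vp_gt0)).
  have /eqP := cvg_derive_eq0 dU Uy U'y.
  rewrite add0r mulf_eq0 [X in _ || X]gt_eqF ?powR_gt0// orbF => /eqP k0.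
  apply/funext => y; have /(congr1 (fun w => w y)) := dk.
  by rewrite k0 /d /=; lra.
have := congr1 (fun w => w xi) qE; rewrite /q /= => qxi.
apply: (is_derive_eq (dV xi)).
rewrite /profile_field -qxi; have /eqP := mass xi; rewrite subr_eq0 => /eqP <-.
by field; rewrite lt_eqF// gt_eqF// powR_gt0.
Qed.

End profile.

(** * The vanishing viscosity limit *)

Theorem theorem1p1 (R : realType) (p : R -> R) (vp up : R)
    (p_smooth : smooth_on [set v | 0 < v] p)
    (p_decreasing : forall v, 0 < v -> derive1 p v < 0)
    (p_convex : forall v, 0 < v -> 0 < derive1n 2 p v)
    (vp_gt0 : 0 < vp) :
  exists2 delta0 : R, 0 < delta0 &
    forall vm um s : R,
    vp < vm -> s < 0 -> up < um ->
    - s * (vp - vm) - (up - um) = 0 ->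
    - s * (up - um) + (p vp - p vm) = 0 ->
    `|vp - vm| <= delta0 ->
    (forall alpha : R, 0 < alpha ->
       exists V U : R -> R, viscous_shock_profile p vm um vp up s alpha V U) /\
    (forall V U : R -> R -> R,
     (forall alpha : R, 0 < alpha ->
        viscous_shock_profile p vm um vp up s alpha (V alpha) (U alpha)) ->
     exists v u : R -> R * R -> R,
       (forall alpha : R, 0 < alpha ->
          navier_stokes_solution p alpha
            (fun x => travelling_wave s alpha (V alpha) (x, 0))
            (fun x => travelling_wave s alpha (U alpha) (x, 0))
            (v alpha) (u alpha)) /\
       (forall h : R, 0 < h ->
          Linfty_norm (away_from_shock s h)
            (fun z => v alpha z - shock s vm vp z)
            (fun z => u alpha z - shock s um up z)
            @[alpha --> 0^'+] --> 0%E)).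
Proof.
exists 1 => // vm um s vpvm s0 upum rh_mass rh_momentum _.
split=> [alpha alpha0|V U VU]; first exact: profile_exists.
exists (fun alpha => travelling_wave s alpha (V alpha)),
  (fun alpha => travelling_wave s alpha (U alpha)); split=> [alpha alpha0|h h0].
  exact: (wave_navier_stokes p_smooth alpha0 (VU _ alpha0)).
have hvm := hugoniot_left_state rh_mass rh_momentum.
pose N (alpha : R) := Linfty_norm (away_from_shock s h)
  (fun z => travelling_wave s alpha (V alpha) z - shock s vm vp z)
  (fun z => travelling_wave s alpha (U alpha) z - shock s um up z).
have N0 alpha : (0 <= N alpha)%E by exact: Lnorm_ge0.
have normP (eps : R) : 0 < eps -> \forall alpha \near 0^'+, (N alpha <= eps%:E)%E.
  (* The error in [U] is [|s|] times the error in [V], so this tolerance for [V] serves both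
     components. *)
  move=> eps0; pose eta := eps / (1 + `|s|).
  have s1 : 0 < 1 + `|s| by rewrite ltr_pwDl.
  have eta0 : 0 < eta by rewrite divr_gt0.
  have [T T0 HT] := profile_field_attraction p_smooth p_convex vp_gt0 vpvm
    s0 hvm ltr01 eta0.
  near=> alpha.
  have alpha0 : 0 < alpha by [].
  have alpha1 : alpha <= 1 by near: alpha; exact: nbhs_right_le.
  (* Then [|x - s t| >= h] forces the profile variable out of [(- T, T)]; the bound [alpha <= 1] is
     what makes [T] valid for this [alpha]. *)
  have alphaT : alpha <= h / T.
    by near: alpha; apply: nbhs_right_le; rewrite divr_gt0.
  have [dV UE] := profile_ode p_smooth vp_gt0 s0 (VU _ alpha0).
  have [Vp Vm] : (forall t, T <= t -> `|V alpha t - vp| <= eta) /\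
      (forall t, t <= - T -> `|V alpha t - vm| <= eta).
    by apply: (HT alpha) => //; [rewrite alpha0|rewrite (profile_shift (VU _ alpha0))].
  have Th : T <= h / alpha by rewrite ler_pdivlMr// mulrC -ler_pdivlMr.
  (* Stated for a general end state [(a, b)] on the line joining [V] and [U], so as to treat both
     sides of the shock; the left state lies on it by the first Rankine-Hugoniot condition. *)
  have bound (a b v : R) : b = up - s * (a - vp) -> `|v - a| <= eta ->
      `|v - a| <= eps /\ `|up - s * (v - vp) - b| <= eps.
    move=> -> va.
    rewrite (_ : up - s * (v - vp) - _ = s * - (v - a)); last by ring.
    rewrite normrM normrN; split.
      apply: (le_trans va); rewrite ler_pdivrMr//.
      by apply: ler_peMr; [exact: ltW|rewrite lerDl].
    apply: (@le_trans _ _ (`|s| * eta)); first exact: ler_wpM2l.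
    rewrite /eta mulrCA; apply: ler_piMr; first exact: ltW.
    by rewrite ler_pdivrMr// mul1r lerDr.
  apply: Linfty_norm_le => [|z [hz _]]; first exact: ltW.
  rewrite /shock /travelling_wave UE; case: ltP => [zs|sz].
    apply: bound; first by lra.
    apply: Vm; apply: (@le_trans _ _ (- (h / alpha))); last by rewrite lerN2.
    rewrite -[leRHS]mulNr ler_pM2r ?invr_gt0//.
    by move: hz; rewrite ltr0_norm ?subr_lt0//; lra.
  apply: bound; first by lra.
  apply: Vp; apply: (le_trans Th); rewrite ler_pM2r ?invr_gt0//.
  by move: hz; rewrite ger0_norm ?subr_ge0.
suff : N alpha @[alpha --> 0^'+] --> (0 : R)%:E by [].
(* Convergence in the extended reals splits into eventual finiteness, from the bound with [eps]
   equal to 1, and convergence of the real values. *)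
apply/fine_cvgP; split.
  near=> alpha; rewrite ge0_fin_numE//.
  apply: (@le_lt_trans _ _ 1%:E); last exact: ltry.
  by near: alpha; exact: normP.
apply/cvgrPdist_le => eps eps0; near=> alpha.
have Neps : (N alpha <= eps%:E)%E by near: alpha; exact: normP.
rewrite sub0r normrN /= ger0_norm ?fine_ge0// -lee_fin fineK//.
by rewrite ge0_fin_numE// (le_lt_trans Neps)// ltry.
Unshelve. all: by end_near. Qed.
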